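(* Let $G$ and $G'$ be mixed graphs, let $P$ be an $\mathbf{A}$-trail in $G$, and let $(\alpha,\beta)$ be any TF-isomorphism from $G$ to $G'$. Then there exists an $\mathbf{A}$-trail $P'$ in $G'$ such that $(\alpha,\beta)$ restricted to $P$ maps $P$ to $P'$, i.e. $P'=\{(\alpha(x),\beta(y)) : (x,y)\in P\}$.
   Context: A mixed graph $G=(V(G),A(G))$ consists of a set $V(G)$ of vertices and a set $A(G)\subseteq V(G)\times V(G)$ of arcs (loops are allowed; no multiple arcs). A TF-isomorphism from $G$ to $H$ is a pair $(\alpha,\beta)$ of bijections $V(G)\to V(H)$ such that $(u,v)\in A(G)$ if and only if $(\alpha(u),\beta(v))\in A(H)$; it maps the arc $(u,v)$ to the arc $(\alpha(u),\beta(v))$. An $\mathbf{A}$-trail (alternating trail) in $G$ is a finite nonempty set $P$ of arcs whose elements can be listed without repetition as $a_1,\dots,a_k$ in such a way that, for suitable vertices $x_0,\dots,x_k$ (repetitions of vertices allowed), the arc $a_i$ joins $x_{i-1}$ and $x_i$ and directions alternate: either $a_i=(x_{i-1},x_i)$ for all odd $i$ and $a_i=(x_i,x_{i-1})$ for all even $i$, or $a_i=(x_i,x_{i-1})$ for all odd $i$ and $a_i=(x_{i-1},x_i)$ for all even $i$. *)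

(* Defs.v *)
From mathcomp Require Import all_boot.
From mathcomp Require Import boolp classical_sets functions cardinality.

Set Implicit Arguments.
Unset Strict Implicit.
Unset Printing Implicit Defensive.

Local Open Scope classical_set_scope.

Record mixed_graph := MixedGraph {
  vertex : Type;
  arcs : set (vertex * vertex)
}.

Arguments arcs : clear implicits.

Definition TF_map (V V' : Type) (alpha beta : V -> V') (e : V * V) : V' * V' :=
  (alpha e.1, beta e.2).

Definition TF_isomorphism (G G' : mixed_graph)
    (alpha beta : vertex G -> vertex G') : Prop :=
  [/\ bijective alpha, bijective beta &
      forall u v, arcs G (u, v) <-> arcs G' (alpha u, beta v)].

Arguments TF_isomorphism : clear implicits.

(* With the usual listing a_1, ..., a_k of arcs and x_0, ..., x_k of vertices,
   the index i : 'I_k stands for i + 1: [a i] is a_(i+1), which joins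
   x_i = [x (inord i)] and x_(i+1) = [x (inord i.+1)].  [fwd i] says whether
   a_(i+1) is directed from x_i to x_(i+1), or the other way round. *)
Definition listed_along (V : Type) (k : nat) (a : 'I_k -> V * V)
    (x : 'I_k.+1 -> V) (fwd : 'I_k -> bool) : Prop :=
  forall i : 'I_k,
    a i = if fwd i then (x (inord i), x (inord i.+1))
          else (x (inord i.+1), x (inord i)).

(* The two alternatives are: the odd-numbered arcs (1-based) are the forward
   ones, or the even-numbered arcs are. *)
Definition A_trail (G : mixed_graph) (P : set (vertex G * vertex G)) : Prop :=
  [/\ P `<=` arcs G, finite_set P, P !=set0 &
      exists (k : nat) (a : 'I_k -> vertex G * vertex G)
             (x : 'I_k.+1 -> vertex G),
        [/\ injective a, range a = P &
            listed_along a x (fun i => odd i.+1) \/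
            listed_along a x (fun i => ~~ odd i.+1)]].

Arguments A_trail : clear implicits.

(* Main.v *)
Require Import Defs.
From mathcomp Require Import all_boot.
From mathcomp Require Import boolp classical_sets functions cardinality.

(** Directions alternate along an A-trail, so each vertex [x_j] of its listing
    is either the tail of both listed arcs next to it or the head of both, and
    which of the two depends only on the parity of [j].  A TF-isomorphism sends
    tails by [alpha] and heads by [beta]; hence it sends both occurrences of
    [x_j] to the same vertex, and the image arcs are listed along the image
    vertices with the same alternation ([listed_along_TF_map]).  They are
    pairwise distinct because [alpha] and [beta] are injective
    ([TF_map_inj]). *)

Local Open Scope classical_set_scope.

Lemma TF_map_inj (V V' : Type) (alpha beta : V -> V') :
  injective alpha -> injective beta -> injective (TF_map alpha beta).
Proof. by move=> inja injb [u v] [u' v'] [/inja -> /injb ->]. Qed.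

(** The arc on either side of [x_j] leaves [x_j] exactly when [fwd j] holds:
    the arc [a_j] to [x_(j+1)] by the meaning of [fwd], the arc from [x_(j-1)]
    because its direction is the opposite one.  So [fwd] also chooses between
    [alpha] and [beta] at each vertex; it is taken on [nat] to be defined at
    the last vertex too. *)
Lemma listed_along_TF_map (V V' : Type) (alpha beta : V -> V') (k : nat)
    (a : 'I_k -> V * V) (x : 'I_k.+1 -> V) (fwd : nat -> bool) :
  (forall n, fwd n.+1 = ~~ fwd n) ->
  listed_along a x (fun i => fwd i) ->
  listed_along (TF_map alpha beta \o a)
    (fun j => if fwd j then alpha (x j) else beta (x j)) (fun i => fwd i).
Proof.
move=> alt ax i.
rewrite /= /TF_map ax !inordK ?ltnS ?(ltnW (ltn_ord i)) // alt.
by case: (fwd i).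
Qed.

Theorem proposition4p1 (G G' : mixed_graph) (P : set (vertex G * vertex G))
    (alpha beta : vertex G -> vertex G')
    (trailP : A_trail G P) (isoGG' : TF_isomorphism G G' alpha beta) :
  exists P' : set (vertex G' * vertex G'),
    A_trail G' P' /\ P' = [set TF_map alpha beta e | e in P].
Proof.
case: isoGG' => /bij_inj inja /bij_inj injb arcE.
case: trailP => PG finP [e0 Pe0] [k [a [x [inj_a ranP ax]]]].
exists [set TF_map alpha beta e | e in P]; split=> //; split.
- by move=> _ [[u v] Puv <-]; apply/arcE/PG.
- exact: finite_image.
- by exists (TF_map alpha beta e0), e0.
have inj_a' : injective (TF_map alpha beta \o a).
  exact: inj_comp (TF_map_inj _ _ _ _ inja injb) inj_a.
have ranP' : range (TF_map alpha beta \o a) = [set TF_map alpha beta e | e in P].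
  by rewrite -ranP image_comp.
exists k, (TF_map alpha beta \o a).
have alongP' := listed_along_TF_map _ _ alpha beta _ a x.
case: ax => ax; eexists; split=> //.
- by left; apply: (alongP' (fun n => odd n.+1)) ax.
- by right; apply: (alongP' (fun n => ~~ odd n.+1)) ax.
Qed.
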